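(* (Jordan–Landau theorem for $\mathbb{F}_q$-matrices.) Fix $k\in\mathbb{Z}_{\ge1}$. For every $n\in\mathbb{Z}_{\ge 1}$, $$\lim_{q\to\infty}\mathrm{Prob}_{A\in\mathrm{Mat}_n(\mathbb{F}_q)}\big(f_A(t)\text{ has } k \text{ distinct irreducible factors}\big)=\lim_{q\to\infty}\mathrm{Prob}_{A\in\mathrm{Mat}_n(\mathbb{F}_q)}\big(f_A(t)\text{ has } k \text{ irreducible factors counted with multiplicity}\big),$$ and, denoting this common value by $c_{n,k}$, we have $c_{n,k}\sim \dfrac{(\log n)^{k-1}}{(k-1)!\,n}$ as $n\to\infty$, i.e. $c_{n,k}\big/\frac{(\log n)^{k-1}}{(k-1)!\,n}\to 1$.
   Context: $q$ ranges over prime powers, $\mathbb{F}_q$ is the finite field with $q$ elements, $A$ is chosen uniformly at random from the set $\mathrm{Mat}_n(\mathbb{F}_q)$ of $n\times n$ matrices over $\mathbb{F}_q$, and $f_A(t)=\det(tI_n-A)\in\mathbb{F}_q[t]$ is its characteristic polynomial. Irreducible factors are monic irreducible factors in $\mathbb{F}_q[t]$. *)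

(* Defs.v *)
From HB Require Import structures.
From mathcomp Require Import all_boot all_order all_algebra all_field.
From mathcomp Require Import all_classical all_reals all_analysis.

Set Implicit Arguments.
Unset Strict Implicit.
Unset Printing Implicit Defensive.

Import Order.TTheory GRing.Theory Num.Theory.
Import numFieldNormedType.Exports.

Local Open Scope classical_set_scope.
Local Open Scope ring_scope.

Definition prime_power (q : nat) : Prop :=
  exists p r : nat, [/\ prime p, (0 < r)%N & q = (p ^ r)%N].

(* q --> prime_power_oo is "q tends to infinity among the prime powers". *)
Definition prime_power_oo : set_system nat := within prime_power \oo.

Global Instance prime_power_oo_proper : ProperFilter prime_power_oo.
Proof.
apply: Build_ProperFilter => -[N _ /(_ (2 ^ N.+1)%N)]; apply.
  by rewrite /=; apply: ltnW; apply: ltnW; exact: ltn_expl.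
by exists 2, N.+1.
Qed.

(* A choice, for every prime power q, of a field with q elements; the values at
   the other q are irrelevant.  Such a field is unique up to isomorphism. *)
Definition finite_fields (Fq : nat -> finFieldType) : Prop :=
  forall q, prime_power q -> #|Fq q| = q.

Lemma finite_fields_exist : exists Fq, finite_fields Fq.
Proof.
have H q : {F : finFieldType | prime_power q -> #|F| = q}.
  case: (pselect (prime_power q)) => [/cid[p /cid[r [pp r0 ->]]]|nq].
    by have [F _ cF] := pPrimePowerField pp r0; exists F.
  by exists 'F_2 => /nq.
by exists (fun q => sval (H q)) => q; exact: (svalP (H q)).
Qed.

Section Defs.
Variable F : finFieldType.
Implicit Types (p f : {poly F}) (k n : nat).

Definition monic_irreducible p := p \is monic /\ irreducible_poly p.

Definition has_distinct_irr_factors k f :=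
  ([set p | monic_irreducible p /\ (p %| f)%R] #= `I_k)%card.

Definition has_irr_factors_with_mult k f :=
  exists s : seq {poly F},
    [/\ forall p, p \in s -> monic_irreducible p,
        f = \prod_(p <- s) p & size s = k].

End Defs.

Definition uniform_prob (R : realType) (T : finType) (E : set T) : R :=
  #|[pred x : T | `[< E x >]]|%:R / #|T|%:R.

Definition prob_distinct (R : realType) (n k : nat) (F : finFieldType) : R :=
  uniform_prob R
    [set A : 'M[F]_n | has_distinct_irr_factors k (char_poly A)].

Definition prob_with_mult (R : realType) (n k : nat) (F : finFieldType) : R :=
  uniform_prob R
    [set A : 'M[F]_n | has_irr_factors_with_mult k (char_poly A)].

(* Main.v *)
(* For every monic f of degree n, at least |GL_n(F_q)| / q^n matrices have
   characteristic polynomial f, so the law of f_A is uniform up to O(1/q).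
   Counting pairs (p, f) with p an irreducible divisor of f, weighted by deg p,
   gives d I_d ~ q^d for the number I_d of monic irreducibles of degree d, and
   then the recursion n c(n,k+1) = sum_(m < n) c(m,k) for the limiting proportion
   c(n,k) of square-free f with k factors.  Lower bounds suffice: the c(n,k) are
   the proportions of permutations of n letters with k cycles, so they add up
   to 1.  Finally, the sums s(n,k) = sum_(m <= n) c(m,k) satisfy
   s(n+1,k+1) = s(n,k+1) + s(n,k)/(n+1), which traps k! s(n,k) between powers of
   the harmonic number H_n and of H_n - k. *)
Require Import Defs.
From mathcomp Require Import all_boot all_order all_algebra.
From mathcomp Require Import all_classical all_reals all_analysis.
From mathcomp Require Import ring lra zify.

Set Implicit Arguments.
Unset Strict Implicit.
Unset Printing Implicit Defensive.

Import Order.TTheory GRing.Theory Num.Theory.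
Import numFieldNormedType.Exports.
Local Open Scope classical_set_scope.
Local Open Scope ring_scope.

Lemma sum_nat_const_seq (T : Type) (s : seq T) (n : nat) :
  (\sum_(x <- s) n = size s * n)%N.
Proof. by rewrite big_const_seq count_predT iter_addn_0 mulnC. Qed.

(** * Monic polynomials over a finite field and their factorization into irreducibles *)

Section Polynomials.
Variable F : finFieldType.
Implicit Types (p f g : {poly F}) (s : seq {poly F}) (k n d : nat).

Local Notation q := #|F|.
Local Notation deg p := (size p).-1.

Definition monics n : seq {poly F} := [seq 'X^n + rVpoly v | v : 'rV[F]_n].

Lemma mem_monics n f : (f \in monics n) = (f \is monic) && (size f == n.+1).
Proof.
have szX v : (size (rVpoly (v : 'rV[F]_n)) < size ('X^n : {poly F}))%N.
  by rewrite size_polyXn ltnS size_poly.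
apply/mapP/andP => [[v _ ->]|[fm /eqP sf]].
  by rewrite monicE lead_coefDl // lead_coefXn eqxx size_polyDl // size_polyXn.
have small : (size (f - 'X^n)%R <= n)%N.
  apply/leq_sizeP => j nj; rewrite coefB coefXn.
  move: nj; rewrite leq_eqVlt => /orP[/eqP<-|nj].
    by rewrite eqxx -[n]/(n.+1.-1) -sf -lead_coefE (monicP fm) subrr.
  by rewrite gtn_eqF // subr0 nth_default // sf.
exists (poly_rV (f - 'X^n)); first by rewrite mem_enum.
by rewrite poly_rV_K // addrC subrK.
Qed.

Lemma uniq_monics n : uniq (monics n).
Proof.
rewrite map_inj_in_uniq ?enum_uniq // => u v _ _ /addrI.
exact: (can_inj rVpolyK).
Qed.

Lemma size_monics n : size (monics n) = (q ^ n)%N.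
Proof. by rewrite size_map -cardE card_mx mul1n. Qed.

Definition mirr p := (p \is monic) && irreducibleb p.

Lemma mirrP p : reflect (monic_irreducible p) (mirr p).
Proof.
by apply: (iffP andP) => -[pm /irreducibleP pi].
Qed.

Lemma mirr_monic p : mirr p -> p \is monic. Proof. by case/andP. Qed.

Lemma mirr_irr p : mirr p -> irreducible_poly p.
Proof. by case/andP => _ /irreducibleP. Qed.

Lemma mirr_deg p : mirr p -> (0 < deg p)%N.
Proof. by move=> /mirr_irr[]; case: (size p) => [|[]]. Qed.

Lemma dvd_mirr p r : mirr p -> mirr r -> (p %| r)%R = (p == r).
Proof.
move=> pi ri; apply/idP/eqP => [pr|->]; last exact: dvdpp.
have [sp _] := mirr_irr pi; have [_ rP] := mirr_irr ri.
have := rP p _ pr; rewrite gtn_eqF // => /(_ isT).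
by rewrite eqp_monic ?mirr_monic// => /eqP.
Qed.

Lemma mirr_dvdM p f g : mirr p -> (p %| f * g)%R = (p %| f)%R || (p %| g)%R.
Proof.
move=> /mirr_irr pi; have [pf|npf] := boolP (p %| f)%R; first exact: dvdp_mulr.
by rewrite Gauss_dvdpr // irreducible_poly_coprime.
Qed.

Lemma mirr_dvd_prod p s : mirr p -> all mirr s ->
  (p %| \prod_(r <- s) r)%R = (p \in s).
Proof.
move=> pi; elim: s => [_|r s ih /= /andP[ri si]].
  by rewrite big_nil dvdp1 in_nil gtn_eqF //; case: (mirr_irr pi).
by rewrite big_cons mirr_dvdM // ih // dvd_mirr // in_cons.
Qed.

Lemma monic_mirr_prod s : all mirr s -> \prod_(r <- s) r \is monic.
Proof.
move=> si; rewrite big_seq; apply: monic_prod => r rs.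
by apply: mirr_monic; exact: (allP si).
Qed.

Lemma degM p f : p \is monic -> f \is monic -> deg (p * f) = (deg p + deg f)%N.
Proof.
move=> pm fm; rewrite size_monicM ?monic_neq0 //.
have := monic_neq0 pm; have := monic_neq0 fm; rewrite -!size_poly_eq0.
by case: (size p) (size f) => [|a] [|b] //=; rewrite addnS.
Qed.

Lemma deg_prod s : all mirr s ->
  deg (\prod_(r <- s) r) = (\sum_(r <- s) deg r)%N.
Proof.
elim: s => [_|r s ih /= /andP[ri si]]; first by rewrite !big_nil size_poly1.
by rewrite !big_cons degM ?ih ?monic_mirr_prod ?mirr_monic.
Qed.

(** Unique factorization: the head of [s1] divides the product of [s2], hence occurs in [s2], and
    can be cancelled on both sides. *)
Lemma prod_mirr_inj s1 s2 : all mirr s1 -> all mirr s2 ->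
  \prod_(r <- s1) r = \prod_(r <- s2) r -> perm_eq s1 s2.
Proof.
elim: s1 s2 => [|p s1 ih] s2 /=.
  case: s2 => // p s2 _ /= /andP[pi s2i]; rewrite big_nil => e.
  have := mirr_dvd_prod pi (s := [::]); rewrite big_nil e big_cons.
  by rewrite dvdp_mulr // => /(_ isT).
move=> /andP[pi s1i] s2i e.
have ps2 : p \in s2 by rewrite -mirr_dvd_prod // -e big_cons dvdp_mulr.
rewrite perm_sym (permPl (perm_to_rem ps2)) perm_cons perm_sym.
apply: ih => //.
  by apply/allP => r /mem_rem; exact: (allP s2i).
move: e; rewrite big_cons (perm_big _ (perm_to_rem ps2)) big_cons /=.
by apply: mulfI; apply: monic_neq0; exact: mirr_monic.
Qed.

(** Strong induction on the size: a nonconstant reducible [f] is a product of two strictly smaller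
    monic polynomials. *)
Lemma mirr_prod_exists f : f \is monic ->
  exists2 s, all mirr s & f = \prod_(r <- s) r.
Proof.
have [m] := ubnP (size f); elim: m f => // m ih f.
rewrite ltnS => sf fm.
have [fi|nfi] := boolP (mirr f).
  by exists [:: f]; rewrite ?big_seq1 //= fi.
have [sf1|sf1] := leqP (size f) 1.
  exists [::] => //; rewrite big_nil.
  have /eqP s1 : size f == 1%N.
    by rewrite eqn_leq sf1 size_poly_gt0 monic_neq0.
  have := fm; rewrite monicE lead_coefE s1 /= => /eqP f0.
  by rewrite (size1_polyC sf1) f0.
have [g [gm g1 gf gdf]] : exists g,
    [/\ g \is monic, size g != 1%N, (size g < size f)%N & (g %| f)%R].
  apply: contrapT => H; move: nfi; rewrite /mirr fm /= => /irreducibleP.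
  apply; split => // g sg gf; rewrite -dvdp_size_eqp // eqn_leq dvdp_leq ?monic_neq0//=.
  rewrite leqNgt; apply/negP => gltf; apply: H.
  have g0 : g != 0 by apply: contraTneq gf => ->; rewrite dvd0p monic_neq0.
  have lg0 : (lead_coef g)^-1 != 0 by rewrite invr_eq0 lead_coef_eq0.
  (* A proper divisor becomes monic after division by its leading coefficient. *)
  exists ((lead_coef g)^-1 *: g); split.
  - by rewrite monicE lead_coefZ mulVf // lead_coef_eq0.
  - by rewrite size_scale.
  - by rewrite size_scale.
  - by rewrite dvdpZl.
have fE : f = (f %/ g) * g by rewrite divpK.
have hm : f %/ g \is monic by move: fm; rewrite {1}fE monicMr.
have sg1 : (1 < size g)%N.
  rewrite ltn_neqAle eq_sym g1 size_poly_gt0 monic_neq0 //.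
have hf : (size ((f %/ g)%R) < size f)%N.
  rewrite size_divp ?monic_neq0 // ltn_subrL.
  by rewrite (leq_trans _ sf1) // andbT; case: (size g) sg1 => [|[]].
have [s1 s1i e1] := ih g (leq_trans gf sf) gm.
have [s2 s2i e2] := ih (f %/ g) (leq_trans hf sf) hm.
exists (s2 ++ s1); first by rewrite all_cat s1i s2i.
by rewrite big_cat /= -e1 -e2.
Qed.

Lemma uniq_prod_dvd s f : uniq s -> all mirr s ->
  (forall p, p \in s -> (p %| f)%R) -> (\prod_(r <- s) r %| f)%R.
Proof.
elim: s => [|p s ih] /=; first by rewrite big_nil dvd1p.
move=> /andP[ps us] /andP[pi si] sf; rewrite big_cons Gauss_dvdp.
  by rewrite sf ?mem_head // ih // => r rs; apply: sf; rewrite in_cons rs orbT.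
by rewrite irreducible_poly_coprime ?mirr_dvd_prod //; exact: mirr_irr.
Qed.

(** * Counting irreducibles and multiples by degree *)

Definition irrs d := [seq p <- monics d | mirr p].

Definition irrs_le n := flatten [seq irrs d | d <- iota 1 n].

Lemma mem_irrs d p : (p \in irrs d) = mirr p && (deg p == d).
Proof.
rewrite mem_filter mem_monics; case: (boolP (mirr p)) => //= pi.
rewrite mirr_monic //=; have := mirr_deg pi; by case: (size p).
Qed.

Lemma mem_irrs_le n p : (p \in irrs_le n) = mirr p && (deg p <= n)%N.
Proof.
apply/flatten_mapP/andP => [[d]|[pi pn]].
  by rewrite mem_iota mem_irrs => /andP[_ dn] /andP[-> /eqP->].
exists (deg p); last by rewrite mem_irrs pi eqxx.
by rewrite mem_iota (mirr_deg pi) add1n ltnS.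
Qed.

Lemma uniq_irrs_le n : uniq (irrs_le n).
Proof.
rewrite /irrs_le; elim: (iota 1 n) (iota_uniq 1 n) => //= d l ih /andP[dl ul].
rewrite cat_uniq ih // filter_uniq ?uniq_monics //= andbT.
apply/hasPn => p /flatten_mapP[e el]; rewrite !mem_irrs => /andP[-> /eqP->] /=.
by apply: contraNneq dl => <-.
Qed.

Lemma size_irrs d : (size (irrs d) <= q ^ d)%N.
Proof. by rewrite -size_monics size_filter count_size. Qed.

Lemma sum_irrs_le n (E : nat -> nat) :
  (\sum_(p <- irrs_le n) E (deg p) = \sum_(1 <= d < n.+1) size (irrs d) * E d)%N.
Proof.
rewrite big_flatten big_map /index_iota subn1 /=; apply: eq_bigr => d _.
rewrite -sum_nat_const_seq big_seq [RHS]big_seq.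
by apply: eq_bigr => p; rewrite mem_irrs => /andP[_ /eqP->].
Qed.

(** Multiplication by [p] is a bijection from the monics of degree [n - deg p] onto the multiples of
    [p] among the monics of degree [n]. *)
Lemma count_multiples p n : p \is monic ->
  count (fun f => p %| f)%R (monics n) =
  (if deg p <= n then q ^ (n - deg p) else 0)%N.
Proof.
move=> pm; case: leqP => pn; last first.
  apply/eqP; rewrite -leqn0 leqNgt -has_count; apply/hasPn => f.
  rewrite mem_monics => /andP[fm /eqP sf].
  apply/negP => /dvdp_leq; rewrite monic_neq0 // sf => /(_ isT).
  by move: pn; case: (size p) => //= m a b; lia.
rewrite -size_filter -size_monics -[RHS](size_map (fun g => p * g)).
apply: perm_size; apply: uniq_perm.
- by rewrite filter_uniq ?uniq_monics.
- by rewrite map_inj_uniq ?uniq_monics //; apply/mulfI/monic_neq0.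
move=> f; rewrite mem_filter; apply/andP/mapP => [[pf fn]|[g gn ->]].
  move: fn; rewrite mem_monics => /andP[fm /eqP sf].
  have fE : f = p * (f %/ p) by rewrite mulrC divpK.
  exists (f %/ p)%R => //; have gm : (f %/ p)%R \is monic.
    by move: fm; rewrite {1}fE monicMl.
  rewrite mem_monics gm /=; have := degM pm gm; rewrite -fE sf /=.
  move=> ->; rewrite addKn; have := monic_neq0 gm.
  by rewrite -size_poly_eq0; case: (size _).
move: gn; rewrite !mem_monics => /andP[gm /eqP sg].
rewrite dvdp_mulr // monicMl // gm /=; split=> //.
have := degM pm gm; rewrite sg /= subnKC // => <-.
by have := size_poly_gt0 (p * g); rewrite mulf_neq0 ?monic_neq0 //; case: (size _).
Qed.

(** * Square-free polynomials with a given number of factors, by double counting *)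

Definition sqfree_split k f := exists s : seq {poly F},
  [/\ uniq s, all mirr s, f = \prod_(r <- s) r & size s = k].

Definition num_split k n := count (fun f => `[< sqfree_split k f >]) (monics n).

Lemma num_split_le k n : (num_split k n <= q ^ n)%N.
Proof. by rewrite -size_monics count_size. Qed.

(** The test matters because subtraction is truncated: without it the value for [n < d.*2] would be
    1 instead of 0. *)
Definition num_square_multiples n d :=
  (if d.*2 <= n then q ^ (n - d.*2) else 0)%N.

Lemma count_square_multiples p n : p \is monic ->
  count (fun f => p ^+ 2 %| f)%R (monics n) = num_square_multiples n (deg p).
Proof.
move=> pm; rewrite count_multiples ?monic_exp //.
by rewrite expr2 degM // addnn.
Qed.

(** At most [q ^ d] irreducibles times [q ^ (n - 2d)] multiples gives [q ^ (n - d)], and [d] is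
    positive. *)
Lemma num_square_multiples_le n d : (0 < d)%N ->
  (size (irrs d) * num_square_multiples n d <= q ^ n.-1)%N.
Proof.
move=> d0; rewrite /num_square_multiples; case: (leqP d.*2 n) => dn;
  last by rewrite muln0.
apply: leq_trans (leq_mul (size_irrs d) (leqnn _)) _; rewrite -expnD.
by apply: leq_pexp2l; [apply/card_gt0P; exists 0|lia].
Qed.

(** The product of the distinct irreducible divisors of [f] divides [f], so its degree is at most
    [n]. *)
Lemma weight_le n f : f \in monics n ->
  (\sum_(p <- irrs_le n) (p %| f)%R * deg p <= n)%N.
Proof.
rewrite mem_monics => /andP[fm /eqP sf].
have ai : all mirr [seq p <- irrs_le n | p %| f]%R.
  by apply/allP => p; rewrite mem_filter mem_irrs_le => /and3P[].
rewrite -[X in (_ <= X)%N]/(n.+1.-1) -sf.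
have -> : (\sum_(p <- irrs_le n) (p %| f)%R * deg p =
           deg (\prod_(p <- [seq p <- irrs_le n | p %| f]) p)%R)%N.
  rewrite deg_prod // big_filter [RHS]big_mkcond; apply: eq_bigr => p _.
  by case: (p %| f)%R; rewrite ?mul1n ?mul0n.
rewrite -!subn1 leq_sub2r // dvdp_leq ?monic_neq0 // uniq_prod_dvd //.
  by rewrite filter_uniq ?uniq_irrs_le.
by move=> p; rewrite mem_filter => /andP[].
Qed.

Lemma weight_sqfree n k f : f \in monics n -> sqfree_split k f ->
  (\sum_(p <- irrs_le n) (p %| f)%R * deg p = n)%N.
Proof.
rewrite mem_monics => /andP[fm /eqP sf] [s [us si fE _]].
transitivity (\sum_(p <- [seq p <- irrs_le n | p %| f]%R) deg p)%N.
  rewrite big_filter [RHS]big_mkcond; apply: eq_bigr => p _.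
  by case: (p %| f)%R; rewrite ?mul1n ?mul0n.
rewrite (perm_big s) /=; first by rewrite -deg_prod // -fE sf.
apply: uniq_perm; rewrite ?filter_uniq ?uniq_irrs_le // => p.
rewrite mem_filter mem_irrs_le.
apply/and3P/idP => [[pf pi _]|ps]; first by rewrite -mirr_dvd_prod // -fE.
have pi : mirr p by exact: (allP si).
have pf : (p %| f)%R by rewrite fE mirr_dvd_prod.
split=> //; rewrite -[n]/(n.+1.-1) -sf -!subn1 leq_sub2r //.
by rewrite dvdp_leq ?monic_neq0.
Qed.

Lemma sqfree_split_or f : f \is monic ->
  (exists k, sqfree_split k f) \/ (exists2 p, mirr p & (p ^+ 2 %| f)%R).
Proof.
move=> /mirr_prod_exists[s si ->]; have [us|/uniqPn] := boolP (uniq s).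
  by left; exists (size s), s.
move=> /(_ 0)[i [j [ij js e]]]; right; exists (nth 0 s i).
  by apply: (allP si); rewrite mem_nth // (ltn_trans ij).
have pi : mirr s`_i by apply: (allP si); rewrite mem_nth // (ltn_trans ij).
(* Cut at [j], the list has the copy of index [i] in its first half and the copy of index [j] at the
   head of its second half. *)
rewrite -[X in \prod_(r <- X) r](cat_take_drop j s) big_cat /= expr2 dvdp_mul //.
  rewrite mirr_dvd_prod //.
    by rewrite -(nth_take 0 ij) mem_nth // size_takel // ltnW.
  by apply/allP => p /mem_take; exact: (allP si).
by rewrite e (drop_nth 0 js) big_cons dvdp_mulr.
Qed.

(** Union bound on the polynomials that are not square-free: each of the [n] degrees contributes at
    most [q ^ n.-1]. This is the source of every O(1/q) error on the polynomial side. *)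
Lemma count_irr_square n :
  (\sum_(f <- monics n) \sum_(p <- irrs_le n) (p ^+ 2 %| f)%R <= n * q ^ n.-1)%N.
Proof.
rewrite exchange_big /=.
have -> : (\sum_(p <- irrs_le n) \sum_(f <- monics n) (p ^+ 2 %| f)%R =
           \sum_(p <- irrs_le n) num_square_multiples n (deg p))%N.
  rewrite big_seq [RHS]big_seq; apply: eq_bigr => p.
  rewrite mem_irrs_le => /andP[/mirr_monic pm _].
  by rewrite -count_square_multiples // -sum1_count [RHS]big_mkcond.
rewrite sum_irrs_le -[X in (_ <= X * _)%N](subn1 n.+1) -sum_nat_const_nat.
rewrite big_nat [X in (_ <= X)%N]big_nat; apply: leq_sum => d /andP[d0 _].
exact: num_square_multiples_le.
Qed.

Lemma sum_weight n :
  (\sum_(f <- monics n) \sum_(p <- irrs_le n) (p %| f)%R * deg p =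
   \sum_(1 <= d < n.+1) size (irrs d) * (d * q ^ (n - d)))%N.
Proof.
rewrite exchange_big /= -(sum_irrs_le n (fun d => d * q ^ (n - d))%N).
rewrite big_seq [RHS]big_seq; apply: eq_bigr => p.
rewrite mem_irrs_le => /andP[/mirr_monic pm pn].
have := count_multiples n pm; rewrite pn => <-.
by rewrite -big_distrl /= mulnC -sum1_count [in RHS]big_mkcond.
Qed.

Lemma sum_irrs_ub n :
  (\sum_(1 <= d < n.+1) size (irrs d) * (d * q ^ (n - d)) <= n * q ^ n)%N.
Proof.
rewrite -sum_weight -size_monics mulnC -sum_nat_const_seq.
rewrite big_seq [X in (_ <= X)%N]big_seq; apply: leq_sum => f; exact: weight_le.
Qed.

(** Only an [f] divisible by the square of an irreducible can have weight below [n]; each such [f]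
    is charged [n], and [count_irr_square] bounds the total charge. *)
Lemma sum_irrs_lb n :
  (n * q ^ n <= \sum_(1 <= d < n.+1) size (irrs d) * (d * q ^ (n - d))
                + n * (n * q ^ n.-1))%N.
Proof.
rewrite -sum_weight -size_monics mulnC -sum_nat_const_seq.
apply: leq_trans (leq_add (leqnn _) (leq_mul (leqnn n) (count_irr_square n))).
rewrite big_distrr -big_split /= big_seq [X in (_ <= X)%N]big_seq.
apply: leq_sum => f fn; move: (fn); rewrite mem_monics => /andP[fm /eqP sf].
have [[k fk]|[p pi pf]] := sqfree_split_or fm.
  by rewrite (weight_sqfree fn fk) leq_addr.
rewrite (leq_trans _ (leq_addl _ _)) // leq_pmulr //.
have pn : p \in irrs_le n.
  rewrite mem_irrs_le pi -[n]/(n.+1.-1) -sf -!subn1 leq_sub2r //.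
  rewrite dvdp_leq ?monic_neq0 // (dvdp_trans _ pf) // expr2 dvdp_mulr //.
by rewrite (big_rem p) //= pf.
Qed.

(** If [g] is square-free with [k] factors, then [p * g] is square-free with [k.+1] factors, unless
    [p] divides [g], and then [p ^+ 2] divides [p * g]. The left side counts such pairs with weight
    [deg p]; a given product [f] collects weight at most [n]. *)
Lemma num_split_rec k n :
  (\sum_(1 <= d < n.+1) size (irrs d) * (d * num_split k (n - d))
   <= n * num_split k.+1 n + n * (n * q ^ n.-1))%N.
Proof.
rewrite -(sum_irrs_le n (fun d => d * num_split k (n - d))%N).
apply: leq_trans (leq_add (leqnn _) (leq_mul (leqnn n) (count_irr_square n))).
have -> : num_split k.+1 n = (\sum_(f <- monics n) `[< sqfree_split k.+1 f >])%N.
  by rewrite /num_split -sum1_count big_mkcond; apply: eq_bigr => f _; case: asboolP.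
rewrite (big_distrr n) (big_distrr n) -big_split /=.
apply: (@leq_trans (\sum_(p <- irrs_le n) \sum_(f <- monics n)
  (deg p * (`[< sqfree_split k.+1 f >] && (p %| f)%R) +
   n * (p ^+ 2 %| f)%R))%N).
  rewrite big_seq [X in (_ <= X)%N]big_seq; apply: leq_sum => p.
  rewrite mem_irrs_le => /andP[pi pn].
  have pm := mirr_monic pi.
  apply: (@leq_trans (\sum_(f <- monics n)
    deg p * (`[< sqfree_split k.+1 f >] && (p %| f)%R || (p ^+ 2 %| f)%R))%N).
    rewrite -big_distrr leq_mul2l; apply/orP; right.
    pose a f := `[< sqfree_split k.+1 f >] && (p %| f)%R || (p ^+ 2 %| f)%R.
    rewrite (_ : \sum_(f <- _) _ = count a (monics n)); last first.
      by rewrite -sum1_count [RHS]big_mkcond; apply: eq_bigr => f _;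
        rewrite -/(a f); case: (a f).
    (* For fixed [p], the map [g |-> p * g] is an injection into the polynomials satisfying [a]. *)
    rewrite /num_split -!size_filter -[X in (X <= _)%N](size_map (fun g => p * g)).
    apply: uniq_leq_size.
      rewrite map_inj_uniq ?filter_uniq ?uniq_monics //.
      by apply/mulfI/monic_neq0.
    move=> f /mapP[g]; rewrite !mem_filter !mem_monics.
    move=> /and3P[/asboolP[s [us si gE ks]] gm /eqP sg] ->.
    rewrite monicMl // gm /=; apply/andP; split; last first.
      have := degM pm gm; rewrite sg /= subnKC // => <-.
      by have := size_poly_gt0 (p * g); rewrite mulf_neq0 ?monic_neq0 //; case: (size _).
    rewrite /a dvdp_mulr // andbT expr2.
    have [pg|npg] := boolP (p %| g)%R; first by rewrite dvdp_mul // orbT.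
    apply/orP; left; apply/asboolP; exists (p :: s); split => /=.
    - by rewrite us andbT -mirr_dvd_prod // -gE.
    - by rewrite pi.
    - by rewrite big_cons gE.
    - by rewrite ks.
  apply: leq_sum => f _; case: (_ && _); case: (_ ^+ 2 %| _)%R; lia.
(* With [f] fixed, the degrees of its irreducible divisors add up to at most [n]. *)
rewrite exchange_big /= big_seq [X in (_ <= X)%N]big_seq.
apply: leq_sum => f fn; rewrite big_split /= -!big_distrr /= leq_add2r.
case: asboolP => fk /=; last by rewrite big1 // => p _; rewrite muln0.
rewrite muln1; apply: leq_trans (weight_le fn).
by apply: leq_sum => p _; rewrite mulnC.
Qed.

(** * Matrices with a prescribed characteristic polynomial *)

Lemma char_poly_conj n (C P : 'M[F]_n) : P \in unitmx ->
  char_poly (invmx P *m C *m P) = char_poly C.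
Proof.
move=> Pu; rewrite /char_poly /char_poly_mx !map_mxM /=.
set Q := map_mx polyC P; set Q' := map_mx polyC (invmx P).
have QQ : Q' *m Q = 1%:M by rewrite -map_mxM mulVmx // map_mx1.
have -> : 'X%:M - Q' *m map_mx polyC C *m Q = Q' *m ('X%:M - map_mx polyC C) *m Q.
  by rewrite mulmxBr mulmxBl scalar_mxC -(mulmxA _ Q' Q) QQ mulmx1.
by rewrite !det_mulmx mulrAC -det_mulmx QQ det1 mul1r.
Qed.

(** Restates the companion matrix, natively of dimension [(size f).-1], in dimension [n], together
    with its shift of the basis row vectors. *)
Lemma companion_exists n f : f \in monics n -> exists2 C : 'M[F]_n,
  char_poly C = f & forall (i : 'I_n) (h : (i.+1 < n)%N),
    delta_mx 0 i *m C = delta_mx 0 (Ordinal h) :> 'rV_n.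
Proof.
rewrite mem_monics => /andP[fm /eqP sf]; have -> : n = (size f).-1 by rewrite sf.
exists (companionmx f); first exact: companionmxK.
by move=> i h; rewrite mulmx_delta_companion.
Qed.

(* With C the companion matrix of f, the map P |-> (P^-1 C P, row 0 of P) is
   injective: row i of P is (row 0 of P) (P^-1 C P)^i. *)
Lemma card_unitmx_le n f : f \in monics n.+1 ->
  (#|[pred P : 'M[F]_n.+1 | P \in unitmx]|
   <= #|[pred A : 'M[F]_n.+1 | char_poly A == f]| * q ^ n.+1)%N.
Proof.
move=> /companion_exists[C Cf Cdelta].
pose phi (P : 'M[F]_n.+1) := (invmx P *m C *m P, row 0 P).
have phi_inj : {in [set P : 'M[F]_n.+1 | P \in unitmx]%SET &, injective phi}.
  move=> P Q; rewrite !inE => Pu Qu [eA e0].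
  suff rows i (h : (i < n.+1)%N) : row (Ordinal h) P = row (Ordinal h) Q.
    by apply/row_matrixP => -[i h].
  elim: i h => [|i ih] h.
    by rewrite (_ : Ordinal h = 0) //; apply: val_inj.
  have h' : (i < n.+1)%N by exact: ltnW.
  have step (X : 'M[F]_n.+1) : X \in unitmx ->
      row (Ordinal h) X = row (Ordinal h') X *m (invmx X *m C *m X).
    move=> Xu; rewrite !rowE -(Cdelta (Ordinal h') h) !mulmxA.
    by rewrite -(mulmxA _ X) mulmxV // mulmx1.
  by rewrite !step // (ih h') eA.
have -> : (q ^ n.+1 = #|[pred v : 'rV[F]_n.+1 | true]|)%N.
  by rewrite -[in LHS](mul1n n.+1) -card_mx; apply: eq_card.
rewrite -cardsE -(card_in_imset phi_inj) -cardX.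
apply: subset_leq_card; apply/fintype.subsetP => _ /imsetP[P Pu ->].
by rewrite !inE andbT /= char_poly_conj ?Cf //; move: Pu; rewrite inE.
Qed.

(** This is |GL_m| >= (1 - m/q) q^(m^2) for m = n + 1, free of subtraction and division. Passing
    from m to m + 1 multiplies the proportion of invertible matrices by 1 - q^-(m+1), which costs at
    most 1/q. *)
Lemma card_unitmx_ge n : (q * q ^ (n.+1 * n.+1)
  <= q * #|[pred P : 'M[F]_n.+1 | P \in unitmx]| + n.+1 * q ^ (n.+1 * n.+1))%N.
Proof.
have q0 : (0 < q)%N by apply/card_gt0P; exists 0.
pose G m := (q ^ 'C(m, 2) * \prod_(1 <= i < m.+1) (q ^ i - 1))%N.
have -> : #|[pred P : 'M[F]_n.+1 | P \in unitmx]| = G n.+1.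
  by rewrite /G -card_GL // cardsT /= card_sub.
have GS m : G m.+1 = (G m * (q ^ m * (q ^ m.+1 - 1)))%N.
  by rewrite /G binS bin1 expnD big_nat_recr //=; nia.
have BS m : (q ^ (m.+1 * m.+1) = q ^ (m * m) * (q ^ m * q ^ m.+1))%N.
  by rewrite -!expnD; congr (q ^ _)%N; lia.
have GB m : (G m <= q ^ (m * m))%N.
  elim: m => [|m ih]; first by rewrite /G big_geq.
  by rewrite GS BS leq_mul // leq_mul // leq_subr.
elim: n.+1 => [|m ih]; first by rewrite /G big_geq // !muln0 addn0.
rewrite GS BS; move: ih (GB m); rewrite expnS.
have := expn_gt0 q m; rewrite q0 /=.
move: (G m) (q ^ (m * m))%N (q ^ m)%N => g b x x0 ih gb.
(* Writing [q * x], that is q^(m+1), as [e.+1] removes the truncated subtraction. *)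
have [e he] : exists e, (q * x = e.+1)%N.
  by case: (q * x)%N (muln_gt0 q x) => [|e]; [rewrite q0 x0|exists e].
rewrite he subn1 /=.
have h1 : (q * b * (x * e.+1) <= (q * g + m * b) * (x * e.+1))%N by rewrite leq_mul.
have h2 : (q * g * x <= b * x * e.+1)%N.
  by rewrite -he; nia.
move: h1 h2; rewrite mulnDl !mulnS !mulSn !mulnDr !mulnA.
move: #|F| => Q; lia.
Qed.

(** Sorts the matrices by characteristic polynomial and bounds each fibre below by
    [card_unitmx_le]. *)
Lemma card_split_ge k n :
  (num_split k n.+1 * #|[pred P : 'M[F]_n.+1 | P \in unitmx]|
   <= #|[pred A : 'M[F]_n.+1 | `[< sqfree_split k (char_poly A) >]]| * q ^ n.+1)%N.
Proof.
have -> : #|[pred A : 'M[F]_n.+1 | `[< sqfree_split k (char_poly A) >]]| =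
   (\sum_(f <- monics n.+1) `[< sqfree_split k f >] *
     #|[pred A : 'M[F]_n.+1 | char_poly A == f]|)%N.
  transitivity (\sum_(A : 'M[F]_n.+1) \sum_(f <- monics n.+1)
      (`[< sqfree_split k f >] * (char_poly A == f)))%N.
    rewrite -sum1_card big_mkcond; apply: eq_bigr => A _ /=.
    have cA : char_poly A \in monics n.+1.
      by rewrite mem_monics char_poly_monic size_char_poly eqxx.
    rewrite (bigD1_seq (char_poly A)) ?uniq_monics //= eqxx muln1 big1 ?addn0.
      by rewrite inE; case: asboolP.
    by move=> f /negPf; rewrite eq_sym => ->; rewrite muln0.
  rewrite exchange_big; apply: eq_bigr => f _.
  rewrite -big_distrr /= -sum1_card [in RHS]big_mkcond; congr (_ * _)%N.
rewrite /num_split -sum1_count big_mkcond !big_distrl /=.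
rewrite big_seq [X in (_ <= X)%N]big_seq; apply: leq_sum => f fn.
case: asboolP => _; rewrite ?mul0n // !mul1n; exact: card_unitmx_le.
Qed.

End Polynomials.

(** * Cycle statistics of random permutations *)

Section CycleProportion.
Variable R : realType.

(* The proportion of permutations of n letters with k cycles: the cycle of a
   given letter has a uniform length n - m, and leaves m letters. *)
Fixpoint cyc (k n : nat) : R :=
  if k is k'.+1 then (\sum_(0 <= m < n) cyc k' m) / n%:R else (n == 0%N)%:R.

Lemma cyc_ge0 k n : 0 <= cyc k n.
Proof. by elim: k n => [|k ih] n //=; rewrite divr_ge0 ?sumr_ge0. Qed.

(** A permutation of [n] letters has at most [n] cycles. After exchanging sums, the recursion
    exhibits the total as an average of totals for [m < n], each equal to 1 by induction. *)
Lemma sum_cyc K n : (n < K)%N -> \sum_(k < K) cyc k n = 1.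
Proof.
elim: K n => // K ih n nK; rewrite big_ord_recl /=.
(* For [n = 0] the terms with positive [k] have denominator 0, so they vanish by the convention on
   inverses. *)
case: n nK => [_|n nK]; first by rewrite eqxx big1 ?addr0 // => i _; rewrite invr0 mulr0.
rewrite add0r -big_distrl /= exchange_big /= (eq_big_nat _ _ (F2 := fun=> 1)).
  by rewrite big_const_nat iter_addr addr0 subn0 divff ?pnatr_eq0.
by move=> m /andP[_ mn]; apply: ih; lia.
Qed.

Lemma cyc_le1 k n : cyc k n <= 1.
Proof.
have kK : (k < (maxn k n).+1)%N by rewrite ltnS leq_maxl.
rewrite -(@sum_cyc (maxn k n).+1 n) ?ltnS ?leq_maxr //.
rewrite (bigD1 (Ordinal kK)) //= lerDl; apply: sumr_ge0 => i _; exact: cyc_ge0.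
Qed.

End CycleProportion.

(** * From counts to densities, with errors O(1/q) *)

Section Densities.
Variables (R : realType) (F : finFieldType).
Local Notation q := (#|F|%:R : R).

Definition irr_density d : R := (size (irrs F d) * d)%:R / q ^+ d.
Definition split_density k n : R := (num_split F k n)%:R / q ^+ n.

Lemma card_field_gt0 : 0 < q.
Proof. by rewrite ltr0n; apply/card_gt0P; exists 0. Qed.

Lemma irr_density_ge0 d : 0 <= irr_density d.
Proof. by rewrite divr_ge0 // exprn_ge0 // ltW // card_field_gt0. Qed.

(** Division by [q ^+ n] turns a convolution of counts into one of densities. It serves for
    [E m = q ^ m] and for [E = num_split F k]. *)
Lemma sum_densityE (E : nat -> nat) n :
  (\sum_(1 <= d < n.+1) size (irrs F d) * (d * E (n - d)))%:R / q ^+ n =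
  \sum_(1 <= d < n.+1) irr_density d * ((E (n - d)%N)%:R / q ^+ (n - d)).
Proof.
rewrite natr_sum mulr_suml big_nat [RHS]big_nat; apply: eq_bigr => d /andP[_ dn].
rewrite -[X in q ^+ X](@subnKC d n) // exprD /irr_density !natrM.
have := card_field_gt0 => q0; field.
by rewrite !expf_neq0 ?gt_eqF.
Qed.

Lemma err_densityE n : (n * (n * #|F| ^ n.-1))%:R / q ^+ n = n%:R ^+ 2 / q.
Proof.
case: n => [|n]; first by rewrite mul0n expr0n !mul0r.
have := card_field_gt0 => q0.
rewrite !natrM natrX /= exprS; field.
by rewrite expf_neq0 ?gt_eqF.
Qed.

Lemma exp_densityE n : (#|F| ^ n)%:R / q ^+ n = 1.
Proof. by rewrite natrX divff // expf_neq0 // gt_eqF // card_field_gt0. Qed.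

Let invq_ge0 n : 0 <= (q ^+ n)^-1.
Proof. by rewrite invr_ge0 exprn_ge0 // ltW // card_field_gt0. Qed.

Lemma sum_irr_density_le n : \sum_(1 <= d < n.+1) irr_density d <= n%:R.
Proof.
have := sum_irrs_ub F n; rewrite -(ler_nat R) => /(ler_wpM2r (invq_ge0 n)).
rewrite (sum_densityE (fun m => #|F| ^ m)%N) natrM -mulrA exp_densityE mulr1.
by under eq_bigr do rewrite exp_densityE mulr1.
Qed.

Lemma sum_irr_density_ge n :
  n%:R - n%:R ^+ 2 / q <= \sum_(1 <= d < n.+1) irr_density d.
Proof.
have := sum_irrs_lb F n; rewrite -(ler_nat R) => /(ler_wpM2r (invq_ge0 n)).
rewrite natrD mulrDl err_densityE (sum_densityE (fun m => #|F| ^ m)%N).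
rewrite natrM -mulrA exp_densityE mulr1 lerBlDr.
by under eq_bigr do rewrite exp_densityE mulr1.
Qed.

(** Subtracts the upper bound on the sum up to [n - 1] from the lower bound on the sum up to [n]. *)
Lemma irr_density_ge n : (0 < n)%N -> 1 - n%:R ^+ 2 / q <= irr_density n.
Proof.
case: n => // n _.
have := sum_irr_density_ge n.+1; rewrite big_nat_recr //=.
have := sum_irr_density_le n.
move: (_ ^+ 2 / _) (\sum_(_ <= _ < _) _) (irr_density _) => a b c.
rewrite -natr1; lra.
Qed.

(** A crude bound, but uniform in [q]: a term of a nonnegative sum is at most the sum. *)
Lemma irr_density_le n d : (0 < d <= n)%N -> irr_density d <= n%:R.
Proof.
move=> /andP[d0 dn]; apply: le_trans (sum_irr_density_le n).
rewrite (bigD1_seq d) ?iota_uniq ?mem_index_iota ?d0 ?ltnS //= lerDl.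
by apply: sumr_ge0 => i _; exact: irr_density_ge0.
Qed.

Lemma split_density_le1 k n : split_density k n <= 1.
Proof.
rewrite -[X in _ <= X](exp_densityE n) ler_wpM2r // ler_nat.
exact: num_split_le.
Qed.

Lemma split_density_rec k n :
  \sum_(0 <= m < n) irr_density (n - m) * split_density k m
  <= n%:R * split_density k.+1 n + n%:R ^+ 2 / q.
Proof.
have := num_split_rec F k n; rewrite -(ler_nat R) => /(ler_wpM2r (invq_ge0 n)).
rewrite natrD mulrDl err_densityE (sum_densityE (num_split F k)) natrM -mulrA.
(* Reindexing by m = n - d. *)
apply: le_trans; rewrite big_add1 /= big_nat_rev /= big_nat [X in _ <= X]big_nat.
apply: ler_sum => m /andP[_ mn]; rewrite add0n.
by rewrite (_ : (n - (n - m.+1)) = m.+1)%N; last lia.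
Qed.

End Densities.

(** Induction on [k] through [split_density_rec], which has the recursion of [cyc] as its limit. The
    constant depends on [k] and [n] but not on the field. *)
Lemma split_density_ge (R : realType) k n : exists2 C : R, 0 <= C &
  forall F : finFieldType, cyc R k n - C / #|F|%:R <= split_density R F k n.
Proof.
elim: k n => [|k ih] n /=.
  exists 0 => // F; rewrite mul0r subr0; case: n => [|n] /=; last first.
    by rewrite divr_ge0 // exprn_ge0 // ltW // card_field_gt0.
  rewrite /split_density expr0 divr1 ler_nat -has_count.
  apply/hasP; exists 1; first by rewrite mem_monics monic1 size_poly1.
  by apply/asboolP; exists [::]; rewrite big_nil.
case: n => [|n].
  exists 0 => // F; rewrite invr0 mulr0 !mul0r subr0.
  by rewrite divr_ge0 // exprn_ge0 // ltW // card_field_gt0.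
have /boolp.choice[C Cge] m : exists c : R, 0 <= c /\
    forall F : finFieldType, cyc R k m - c / #|F|%:R <= split_density R F k m.
  by have [c c0 cP] := ih m; exists c.
set N : R := n.+1%:R.
have N0 : 0 < N by rewrite ltr0n.
(* In the recursion multiplied by [N], each [m] loses [N * (N + C m) / x] and the non-square-free
   polynomials cost [N ^+ 2 / x]; dividing by [N] gives this constant. *)
exists (N + \sum_(0 <= m < n.+1) (N + C m)).
  by rewrite addr_ge0 ?sumr_ge0 // ?ltW // => m _;
    rewrite addr_ge0 ?(ltW N0) //; case: (Cge m).
move=> F; set x := #|F|%:R.
have x0 : 0 < x by exact: card_field_gt0.
rewrite -(ler_pM2l N0) -(lerD2r (N ^+ 2 / x)).
apply: le_trans (split_density_rec _ _ _ _).
apply: (@le_trans _ _ (\sum_(0 <= m < n.+1) (cyc R k m - N * (N + C m) / x))).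
  rewrite [X in _ <= X]big_split /= sumrN -mulr_suml -mulr_sumr.
  set S1 := \sum_(_ <= _ < _) _; set S2 := \sum_(_ <= _ < _) _.
  rewrite le_eqVlt; apply/orP; left; apply/eqP; field.
  by rewrite !gt_eqF.
rewrite big_nat [X in _ <= X]big_nat; apply: ler_sum => m /andP[_ mn].
have [C0 /(_ F) CP] := Cge m.
set i := irr_density _ _ _.
have iN : i <= N by apply: irr_density_le; lia.
have i0 : 0 <= i by exact: irr_density_ge0.
have i1 : 1 - N ^+ 2 / x <= i.
  have d0 : (0 < n.+1 - m)%N by lia.
  apply: le_trans (irr_density_ge R F d0).
  by rewrite lerD2l lerN2 ler_pM2r ?invr_gt0 // lerXn2r ?nnegrE ?ler_nat ?leq_subr ?ler0n.
apply: le_trans (ler_wpM2l i0 CP); rewrite -/x.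
have c0 := cyc_ge0 R k m; have c1 := cyc_le1 R k m.
have xi0 : 0 < x^-1 by rewrite invr_gt0.
move: (cyc R k m) (C m) C0 c0 c1 => c D D0 c0 c1.
(* The product [i * (c - D / x)] is bounded below by using [i >= 1 - N ^+ 2 / x] with [c <= 1] in
   its first term, and [i <= N] in its second. *)
have h1 : (1 - N ^+ 2 / x) * c <= i * c by rewrite ler_wpM2r.
have h2 : i * (D / x) <= N * (D / x) by rewrite ler_wpM2r // mulr_ge0 // ltW.
have h3 : N ^+ 2 / x * c <= N ^+ 2 / x by rewrite ler_piMr // mulr_ge0 ?exprn_ge0 // ltW.
rewrite mulrBr (_ : N * (N + D) / x = N ^+ 2 / x + N * (D / x)); last by ring.
move: h1; rewrite mulrBl mul1r; lra.
Qed.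

(** * Probabilities for random matrices *)

Lemma card_matrix (R : realType) (F : finFieldType) n :
  #|{: 'M[F]_n}|%:R = #|F|%:R ^+ (n * n) :> R.
Proof. by rewrite card_mx natrX. Qed.

(** The probability is at least the split density times the proportion of invertible matrices. The
    first loses [C / q], the second [n.+1 / q], and the density is at most 1. *)
Lemma prob_split_ge (R : realType) k n : exists2 C : R, 0 <= C &
  forall F : finFieldType, cyc R k n.+1 - C / #|F|%:R <=
    Defs.uniform_prob R [set A : 'M[F]_n.+1 | sqfree_split k (char_poly A)].
Proof.
have [C C0 CP] := split_density_ge R k n.+1.
exists (C + n.+1%:R) => [|F]; first by rewrite addr_ge0 ?ler0n.
have := card_field_gt0 R F; have := CP F; rewrite /split_density.
have := @split_density_le1 R F k n.+1; rewrite /split_density.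
have := card_split_ge F k n; have := card_unitmx_ge F n.
rewrite -!(ler_nat R) natrD !natrM !natrX /Defs.uniform_prob card_matrix.
set x : R := #|F|%:R; set U : R := #|_|%:R; set S := (num_split _ _ _)%:R.
rewrite (_ : #|[pred A | `[< _ A >]]| =
  #|[pred A : 'M[F]_n.+1 | `[< sqfree_split k (char_poly A) >]]|) //.
set T : R := #|_|%:R; set N : R := n.+1%:R.
move=> hU hS s1 hC x0.
set y := x ^+ n.+1 in hS s1 hC *; set z := x ^+ _ in hU *.
have y0 : 0 < y by rewrite exprn_gt0.
have z0 : 0 < z by rewrite exprn_gt0.
have s0 : 0 <= S / y by rewrite divr_ge0 // ltW.
have hU' : 1 - N / x <= U / z.
  rewrite ler_pdivlMr // mulrBl mul1r lerBlDr -(ler_pM2l x0) mulrDr.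
  by rewrite (_ : x * (N / x * z) = N * z) //; field; rewrite gt_eqF.
have hS' : S / y * (U / z) <= T / z.
  rewrite mulrA ler_pM2r ?invr_gt0 // mulrAC ler_pdivrMr //.
apply: le_trans hS'; apply: le_trans (ler_wpM2l s0 hU').
have h : S / y * (N / x) <= N / x by rewrite ler_piMl // divr_ge0 // ltW.
by rewrite mulrBr mulr1 mulrDl; lra.
Qed.

Lemma sqfree_split_inj (F : finFieldType) j k (f : {poly F}) :
  sqfree_split j f -> sqfree_split k f -> j = k.
Proof.
move=> [s [_ si -> <-]] [t [_ ti e <-]].
exact/perm_size/prod_mirr_inj.
Qed.

(* The lower bounds on the probabilities of the events "square-free with j
   factors" have total 1 - O(1/q), so they are sharp up to O(1/q). *)
Lemma prob_event_bound (R : realType) k n : exists C : R,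
  forall (F : finFieldType) (E : set {poly F}),
    (forall f, sqfree_split k f -> E f) ->
    (forall f j, E f -> sqfree_split j f -> j = k) ->
    `| Defs.uniform_prob R [set A : 'M[F]_n.+1 | E (char_poly A)] - cyc R k n.+1 |
    <= C / #|F|%:R.
Proof.
have /boolp.choice[C CP] j : exists c : R, 0 <= c /\ forall F : finFieldType,
    cyc R j n.+1 - c / #|F|%:R <=
    Defs.uniform_prob R [set A : 'M[F]_n.+1 | sqfree_split j (char_poly A)].
  by have [c c0 cP] := prob_split_ge R j n; exists c.
(* [K] exceeds both [k], so that [k] is among the indices, and [n.+1], so that [sum_cyc] applies. *)
pose K := (maxn k n.+1).+1.
have kK : (k < K)%N by rewrite ltnS leq_maxl.
exists (\sum_(j < K) C j) => F E Ek Euniq.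
have q0 : 0 < (#|F|%:R : R) := @card_field_gt0 R F.
pose P (j : nat) := Defs.uniform_prob R [set A : 'M[F]_n.+1 | sqfree_split j (char_poly A)].
pose M := 'M[F]_n.+1.
have m0 : 0 < (#|{: M}|%:R : R) by rewrite card_matrix exprn_gt0.
set p := Defs.uniform_prob _ _.
have probE (A : set M) : Defs.uniform_prob R A = (\sum_(x : M) `[< A x >]%:R) / #|{: M}|%:R.
  rewrite /Defs.uniform_prob -sum1_card natr_sum big_mkcond; congr (_ / _).
  by apply: eq_bigr => x _ /=; rewrite inE; case: asboolP.
have lb : cyc R k n.+1 - C k / #|F|%:R <= p.
  apply: (le_trans ((CP k).2 F)); rewrite /p !probE ler_pM2r ?invr_gt0 //.
  apply: ler_sum => A _; rewrite ler_nat.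
  by case: (asboolP (E _)) => //; case: asboolP => // /Ek.
(* The event [E] and the square-free events with [j != k] factors are pairwise disjoint. *)
have ub : p + \sum_(j < K | j != k :> nat) P j <= 1.
  rewrite /p probE (eq_bigr _ (fun j _ => probE _)) -mulr_suml -mulrDl.
  rewrite ler_pdivrMr // mul1r exchange_big -big_split /=.
  rewrite -sum1_card natr_sum big_mkcond /=.
  apply: ler_sum => A _ /=.
  rewrite -natr_sum -natrD ler_nat.
  case: (asboolP (E _)) => [EA|nEA].
    rewrite big1 // => j jk; case: asboolP => // /(Euniq _ _ EA) e.
    by rewrite e eqxx in jk.
  rewrite add0n; have [[i Ai]|H] :=
    pselect (exists i : nat, sqfree_split i (char_poly A)); last first.
    by rewrite big1 // => j _; case: asboolP => // Aj; case: H; exists j.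
  apply: (@leq_trans (\sum_(j < K) (j == i :> nat))%N).
    rewrite big_mkcond; apply: leq_sum => j _; case: ifP => // _.
    by case: asboolP => // /(sqfree_split_inj Ai) ->; rewrite eqxx.
  rewrite (eq_bigr (fun j : 'I_K => if (j : nat) == i then 1 else 0)%N);
    last by move=> j _; case: eqP.
  rewrite -big_mkcond sum1_card; apply/card_le1_eqP => a b.
  by rewrite !unfold_in => /eqP ai /eqP bi; apply: val_inj; rewrite /= ai bi.
have lbs : \sum_(j < K | j != k :> nat) (cyc R j n.+1 - C j / #|F|%:R) <=
    \sum_(j < K | j != k :> nat) P j.
  by apply: ler_sum => j _; exact: ((CP j).2 F).
have := @sum_cyc R K n.+1; rewrite ltnS leq_maxr => /(_ isT).
rewrite (bigD1 (Ordinal kK)) //= => sc.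
rewrite (bigD1 (Ordinal kK)) //= mulrDl.
move: lbs; rewrite big_split /= sumrN -mulr_suml.
rewrite (eq_bigl (fun j => j != Ordinal kK)) // => lbs.
move: lbs; rewrite [X in _ - X / _](eq_bigl (fun j => j != Ordinal kK)) // => lbs.
have sC0 : 0 <= (\sum_(j < K | j != Ordinal kK) C j) / #|F|%:R.
  by rewrite divr_ge0 ?(ltW q0) // sumr_ge0 // => j _; exact: (CP j).1.
have Ck0 : 0 <= C k / #|F|%:R by rewrite divr_ge0 ?(ltW q0) //; exact: (CP k).1.
(* Since the [cyc R j n.+1] add up to 1, [ub] and [lbs] bound [p] above by [cyc R k n.+1] plus the
   sum of the [C j / q] over [j != k]. *)
rewrite ler_norml; apply/andP; split; lra.
Qed.

(** [E] stands for either event of the theorem: on square-free polynomials both say that there are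
    [k] factors, and the others have probability O(1/q). *)
Lemma prob_event_cvg (R : realType) k n (Fq : nat -> finFieldType)
    (E : forall F : finFieldType, set {poly F}) :
  finite_fields Fq ->
  (forall F f, sqfree_split k f -> E F f) ->
  (forall F f j, E F f -> sqfree_split j f -> j = k) ->
  Defs.uniform_prob R [set A : 'M[Fq q]_n.+1 | E (Fq q) (char_poly A)]
    @[q --> prime_power_oo] --> cyc R k n.+1.
Proof.
move=> Fqq Ek Euniq; have [C CP] := prob_event_bound R k n.
have inv0 : C / q%:R @[q --> prime_power_oo] --> (0 : R).
  apply: cvg_within_filter.
  have invn : (q%:R : R)^-1 @[q --> \oo] --> (0 : R).
    by apply/gtr0_cvgV0; [exists 1%N => // m /= m1; rewrite ltr0n|exact: cvgr_idn].
  by have := cvgM (cvg_cst C) invn; rewrite mulr0; apply.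
apply: (@squeeze_cvgr _ _ _ _ (fun q => cyc R k n.+1 - C / q%:R)
  (fun q => cyc R k n.+1 + C / q%:R)).
- rewrite /prime_power_oo near_withinE; apply: nearW => q pq.
  have := CP (Fq q) (E (Fq q)) (Ek _) (Euniq _).
  by rewrite ler_norml (Fqq q pq) => /andP[lo hi]; apply/andP; split; lra.
- by have := cvgB (cvg_cst (cyc R k n.+1)) inv0; rewrite subr0; apply.
- by have := cvgD (cvg_cst (cyc R k n.+1)) inv0; rewrite addr0; apply.
Qed.

(** * The two events of the theorem on square-free polynomials *)

Lemma sqfree_split_with_mult (F : finFieldType) k (f : {poly F}) :
  sqfree_split k f -> has_irr_factors_with_mult k f.
Proof.
by move=> [s [_ si fE sk]]; exists s; split => // p /(allP si)/mirrP.
Qed.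

Lemma with_mult_sqfree_split (F : finFieldType) j k (f : {poly F}) :
  has_irr_factors_with_mult k f -> sqfree_split j f -> j = k.
Proof.
move=> [s [si fE <-]] [t [_ ti tE <-]]; apply/perm_size/prod_mirr_inj => //.
  by apply/allP => p /si/mirrP.
by rewrite -fE -tE.
Qed.

(** Links set-theoretic cardinality to the length of a list, removing the head at each step. *)
Lemma card_eq_uniq_seq (T : eqType) (s : seq T) :
  uniq s -> ([set` s] #= `I_(size s))%card.
Proof.
elim: s => [_|x s ih /= /andP[xs us]].
  by rewrite II0 card_eq0; apply/eqP/seteqP; split.
apply/eq_cardSP; exists x; first by rewrite /= mem_head.
rewrite (_ : _ `\ _ = [set` s]); first exact: ih.
apply/seteqP; split => y /=.
  by rewrite in_cons => -[/predU1P[->|//]].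
move=> ys; rewrite in_cons ys orbT; split=> // yx.
by rewrite -yx ys in xs.
Qed.

Lemma sqfree_split_distinct (F : finFieldType) k (f : {poly F}) :
  sqfree_split k f -> has_distinct_irr_factors k f.
Proof.
move=> [s [us si -> <-]]; rewrite /has_distinct_irr_factors.
rewrite (_ : [set p | _] = [set` s]).
  exact: card_eq_uniq_seq.
apply/seteqP; split => p /=.
  by move=> [/mirrP pi]; rewrite mirr_dvd_prod.
move=> ps; have pi := allP si p ps; split; first exact/mirrP.
by rewrite mirr_dvd_prod.
Qed.

Lemma distinct_sqfree_split (F : finFieldType) j k (f : {poly F}) :
  has_distinct_irr_factors k f -> sqfree_split j f -> j = k.
Proof.
rewrite /has_distinct_irr_factors => fk /sqfree_split_distinct fj.
apply/card_eq_II; apply: card_eq_trans fk.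
by rewrite card_eq_sym.
Qed.

(** * Asymptotics of the cycle proportions *)

Section CycleAsymptotics.
Variable R : realType.
Implicit Types (k n : nat).

Local Notation H n := (series (@harmonic R) n).

(** Mean value bound for the power function, by induction on [k] from y^(k+2) - x^(k+2) = x (y^(k+1)
    - x^(k+1)) + y^(k+1) (y - x). *)
Lemma exprS_sub_ge (x y : R) k : 0 <= x <= y ->
  k.+1%:R * x ^+ k * (y - x) <= y ^+ k.+1 - x ^+ k.+1.
Proof.
move=> /andP[x0 xy]; elim: k => [|k ih]; first by rewrite expr0 !expr1 !mul1r.
have h1 : x * (k.+1%:R * x ^+ k * (y - x)) <= x * (y ^+ k.+1 - x ^+ k.+1).
  by rewrite ler_wpM2l.
have h2 : x ^+ k.+1 * (y - x) <= y ^+ k.+1 * (y - x).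
  by rewrite ler_wpM2r ?subr_ge0 // lerXn2r // nnegrE // (le_trans x0).
rewrite -[k.+2%:R]natr1 (exprS y k.+1) (exprS x k.+1).
rewrite (_ : y * y ^+ k.+1 - x * x ^+ k.+1 =
  x * (y ^+ k.+1 - x ^+ k.+1) + y ^+ k.+1 * (y - x)); last by ring.
rewrite (_ : (k.+1%:R + 1) * x ^+ k.+1 * (y - x) =
  x * (k.+1%:R * x ^+ k * (y - x)) + x ^+ k.+1 * (y - x)); first exact: lerD.
by rewrite (exprS x k); ring.
Qed.

(** Same induction, with the roles of [x] and [y] exchanged in the decomposition. *)
Lemma exprS_sub_le (x y : R) k : 0 <= x <= y ->
  y ^+ k.+1 - x ^+ k.+1 <= k.+1%:R * y ^+ k * (y - x).
Proof.
move=> /andP[x0 xy]; have y0 := le_trans x0 xy.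
elim: k => [|k ih]; first by rewrite expr0 !expr1 !mul1r.
have h1 : y * (y ^+ k.+1 - x ^+ k.+1) <= y * (k.+1%:R * y ^+ k * (y - x)).
  by rewrite ler_wpM2l.
have h2 : x ^+ k.+1 * (y - x) <= y ^+ k.+1 * (y - x).
  by rewrite ler_wpM2r ?subr_ge0 // lerXn2r // nnegrE.
rewrite -[k.+2%:R]natr1 (exprS y k.+1) (exprS x k.+1).
rewrite (_ : y * y ^+ k.+1 - x * x ^+ k.+1 =
  y * (y ^+ k.+1 - x ^+ k.+1) + x ^+ k.+1 * (y - x)); last by ring.
rewrite (_ : (k.+1%:R + 1) * y ^+ k.+1 * (y - x) =
  y * (k.+1%:R * y ^+ k * (y - x)) + y ^+ k.+1 * (y - x)); first exact: lerD.
by rewrite (exprS y k); ring.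
Qed.

Lemma seriesHS n : H n.+1 = H n + n.+1%:R^-1.
Proof. by rewrite /series /= big_nat_recr. Qed.

Lemma harmonic_series_ge0 n : 0 <= H n.
Proof. by rewrite /series /= sumr_ge0. Qed.

(** The increment ln (1 + 1/(n+1)) is at most 1/(n+1). *)
Lemma ln_le_harmonic n : ln n.+1%:R <= H n.
Proof.
elim: n => [|n ih]; first by rewrite /series /= big_geq // ln1.
have n0 : (0 : R) < n.+1%:R by rewrite ltr0n.
have -> : n.+2%:R = n.+1%:R * (1 + n.+1%:R^-1) :> R.
  by rewrite mulrDr mulr1 divff ?gt_eqF // natr1.
have i0 : (0 : R) < n.+1%:R^-1 by rewrite invr_gt0.
rewrite lnM ?posrE ?addr_gt0 // seriesHS lerD // le_ln1Dx //.
by apply: lt_trans i0; rewrite ltrN10.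
Qed.

(** Going down from n + 2 to n + 1, the logarithm changes by ln (1 - 1/(n+2)) <= -1/(n+2). *)
Lemma harmonic_le_ln n : H n.+1 <= 1 + ln n.+1%:R.
Proof.
elim: n => [|n ih].
  by rewrite seriesHS /series /= big_geq // add0r invr1 ln1 addr0.
rewrite seriesHS; apply: le_trans (lerD ih (lexx _)) _.
rewrite -addrA lerD2l.
have n1 : (0 : R) < n.+1%:R by rewrite ltr0n.
have n2 : (0 : R) < n.+2%:R by rewrite ltr0n.
have -> : n.+1%:R = n.+2%:R * (1 + - n.+2%:R^-1) :> R.
  by rewrite mulrBr mulr1 divff ?gt_eqF // -[n.+2%:R]natr1 addrK.
have i1 : (n.+2%:R : R)^-1 < 1 by rewrite invf_lt1 // ltr1n.
rewrite lnM ?posrE ?subr_gt0 // -addrA gerDl.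
have := @le_ln1Dx R (- n.+2%:R^-1); rewrite ltrN2 => /(_ i1).
by move=> h; rewrite -lerBrDr sub0r.
Qed.

(** The upper index is included, so that [cyc R k.+1 n.+1] is [cyc_sum k n / n.+1]. *)
Definition cyc_sum k n : R := \sum_(0 <= m < n.+1) cyc R k m.

Lemma cyc_sum_ge0 k n : 0 <= cyc_sum k n.
Proof. by apply: sumr_ge0 => m _; exact: cyc_ge0. Qed.

Lemma cyc_sum0 n : cyc_sum 0 n = 1.
Proof. by rewrite /cyc_sum big_nat_recl //= big1 ?addr0. Qed.

Lemma cyc_sumS0 k : cyc_sum k.+1 0 = 0.
Proof. by rewrite /cyc_sum big_nat1 /= invr0 mulr0. Qed.

Lemma cyc_sumSS k n : cyc_sum k.+1 n.+1 = cyc_sum k.+1 n + cyc_sum k n / n.+1%:R.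
Proof. by rewrite {1}/cyc_sum big_nat_recr. Qed.

(** From [n] to [n.+1], with exponent [k.+1], the left side grows by k+1 times
    [k! * cyc_sum k n / n.+1], and the right side by at least k+1 times [H n ^+ k / n.+1]. *)
Lemma cyc_sum_le k n : k`!%:R * cyc_sum k n <= H n ^+ k.
Proof.
elim: k n => [|k ihk] n; first by rewrite cyc_sum0 mulr1.
elim: n => [|n ihn]; first by rewrite cyc_sumS0 mulr0 exprn_ge0 ?harmonic_series_ge0.
have i0 : 0 <= (n.+1%:R : R)^-1 by rewrite invr_ge0.
rewrite cyc_sumSS seriesHS mulrDr factS natrM.
rewrite (_ : _ * (_ / _) = k.+1%:R * (k`!%:R * cyc_sum k n) * n.+1%:R^-1); last by ring.
have h0 := harmonic_series_ge0 n.
have := @exprS_sub_ge (H n) (H n + n.+1%:R^-1) k.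
rewrite h0 lerDl i0 => /(_ isT); rewrite addrAC subrr add0r => h1.
have h2 : k.+1%:R * (k`!%:R * cyc_sum k n) * n.+1%:R^-1 <= k.+1%:R * H n ^+ k / n.+1%:R.
  by rewrite ler_wpM2r // ler_wpM2l.
move: ihn; rewrite factS natrM => h3.
by apply: le_trans (lerD h3 h2) _; rewrite addrC -lerBrDr.
Qed.

(** The mean value bound now takes the power at the new endpoint. The shift by [k] absorbs this, as
    harmonic steps are at most 1: [H n.+1 - k.+1 <= H n - k]. Truncation at 0 keeps the powers
    monotone. *)
Lemma cyc_sum_ge k n : Num.max 0 (H n - k%:R) ^+ k <= k`!%:R * cyc_sum k n.
Proof.
elim: k n => [|k ihk] n; first by rewrite cyc_sum0 mulr1 expr0.
have nn m : 0 <= k.+1`!%:R * cyc_sum k.+1 m by rewrite mulr_ge0 ?cyc_sum_ge0.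
elim: n => [|n ihn].
  by rewrite /series /= big_geq // sub0r max_l ?expr0n ?nn // oppr_le0.
have [z0|z0] := leP (H n.+1 - k.+1%:R) 0; first by rewrite expr0n nn.
have i0 : 0 <= (n.+1%:R : R)^-1 by rewrite invr_ge0.
have i1 : (n.+1%:R : R)^-1 <= 1 by rewrite invf_le1 ?ler1n // ltr0n.
set w := Num.max 0 (H n - k.+1%:R) in ihn.
set z := H n.+1 - k.+1%:R in z0 *.
have zE : z = H n - k.+1%:R + n.+1%:R^-1 by rewrite /z seriesHS addrAC.
have w0 : 0 <= w by rewrite le_max lexx.
have wz : w <= z by rewrite ge_max ltW // zE lerDl.
have zw : z - w <= n.+1%:R^-1.
  by rewrite lerBlDr zE addrC lerD2l le_max lexx orbT.
have hz : z ^+ k <= k`!%:R * cyc_sum k n.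
  apply: le_trans (ihk n); rewrite lerXn2r ?nnegrE ?(ltW z0) // ?le_max ?lexx //.
  by apply/orP; right; rewrite zE -[k.+1%:R]natr1 opprD addrA
    -(addrA (H n - k%:R)) gerDl addrC subr_le0.
rewrite cyc_sumSS mulrDr factS natrM.
rewrite (_ : _ * (_ / _) = k.+1%:R * (k`!%:R * cyc_sum k n) * n.+1%:R^-1); last by ring.
have := @exprS_sub_le w z k; rewrite w0 wz => /(_ isT) h.
have h1 : k.+1%:R * z ^+ k * (z - w) <= k.+1%:R * z ^+ k * n.+1%:R^-1.
  by rewrite ler_wpM2l // mulr_ge0 // exprn_ge0 // ltW.
have h2 : k.+1%:R * z ^+ k * n.+1%:R^-1 <= k.+1%:R * (k`!%:R * cyc_sum k n) * n.+1%:R^-1.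
  by rewrite ler_wpM2r // ler_wpM2l.
move: ihn; rewrite factS natrM => h3; apply: le_trans (lerD h3 h2).
by rewrite addrC -lerBlDr (le_trans h) // (le_trans h1).
Qed.

Lemma cvg_ln_nat : ln n%:R @[n --> \oo] --> (+oo : set_system R).
Proof.
apply/cvgryPge => M; near=> n.
have en : expR M <= n%:R by near: n; exact: nbhs_infty_ger.
by rewrite -(expRK M) ler_ln // posrE ?expR_gt0 // (lt_le_trans _ en) ?expR_gt0.
Unshelve. all: by end_near. Qed.

(** The ratio equals [k! * cyc_sum k n.-1 / ln n ^+ k], and the harmonic sum up to [n.-1] lies
    between [ln n] and [1 + ln n]. *)
Lemma cvg_cyc_ratio k :
  cyc R k.+1 n / (ln n%:R ^+ k / (k`!%:R * n%:R)) @[n --> \oo] --> (1 : R).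
Proof.
have lnV : (ln n%:R : R)^-1 @[n --> \oo] --> (0 : R).
  apply/gtr0_cvgV0; last exact: cvg_ln_nat.
  by exists 2%N => // n /= n2; rewrite ln_gt0 // ltr1n.
have expk (u : nat -> R) : u n @[n --> \oo] --> (1 : R) ->
    u n ^+ k @[n --> \oo] --> (1 : R).
  move=> u1; elim: (k) => [|j ih]; first exact: cvg_cst.
  under eq_fun do rewrite exprS.
  by have := cvgM u1 ih; rewrite mulr1; apply.
apply: (@squeeze_cvgr _ _ _ _ (fun n => (1 - k%:R * (ln n%:R)^-1) ^+ k)
  (fun n => (1 + (ln n%:R)^-1) ^+ k)).
- near=> n.
  have n1 : (1 < n)%N by near: n; exact: nbhs_infty_gt.
  (* Makes the base [ln n - k] nonnegative, as monotonicity of powers requires. *)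
  have Lk : k%:R <= ln (n%:R : R).
    by near: n; exact: (cvgryPge _).1 cvg_ln_nat _.
  have L0 : 0 < ln (n%:R : R) by rewrite ln_gt0 // ltr1n.
  have nn : n = n.-1.+1 by rewrite prednK // ltnW.
  have -> : cyc R k.+1 n / (ln n%:R ^+ k / (k`!%:R * n%:R)) =
            k`!%:R * cyc_sum k n.-1 / ln n%:R ^+ k.
    rewrite /= /cyc_sum -nn; field.
    by rewrite expf_neq0 ?gt_eqF // ?ltr0n ?fact_gt0 // ltnW.
  rewrite -[X in _ - _ * X]div1r (_ : 1 - _ = (ln n%:R - k%:R) / ln n%:R); last first.
    by field; rewrite gt_eqF.
  rewrite (_ : 1 + _ = (1 + ln n%:R) / ln n%:R); last by field; rewrite gt_eqF.
  rewrite !expr_div_n !ler_pM2r ?invr_gt0 ?exprn_gt0 //.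
  have lnH := ln_le_harmonic n.-1; rewrite -nn in lnH.
  have Hln := harmonic_le_ln n.-1; rewrite -nn in Hln.
  apply/andP; split.
    apply: le_trans (cyc_sum_ge _ _); rewrite lerXn2r ?nnegrE ?subr_ge0 //.
      by rewrite le_max lexx.
    by rewrite le_max lerD2r lnH orbT.
  apply: le_trans (cyc_sum_le _ _) _; rewrite lerXn2r ?nnegrE ?harmonic_series_ge0 //.
    by rewrite addr_ge0 // ltW.
  apply: le_trans Hln; rewrite [in X in _ <= X]nn seriesHS lerDl invr_ge0 //.
- apply: expk.
  have := cvgB (cvg_cst (1 : R)) (cvgM (cvg_cst (k%:R : R)) lnV).
  by rewrite mulr0 subr0; apply.
- by apply: expk; have := cvgD (cvg_cst (1 : R)) lnV; rewrite addr0; apply.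
Unshelve. all: by end_near. Qed.

End CycleAsymptotics.

Theorem theorem1p6 (R : realType) (k : nat) (hk : (1 <= k)%N) :
  exists c : nat -> R,
    (forall Fq : nat -> finFieldType, finite_fields Fq ->
     forall n : nat, (1 <= n)%N ->
       (prob_distinct R n k (Fq q) @[q --> prime_power_oo] --> c n) /\
       (prob_with_mult R n k (Fq q) @[q --> prime_power_oo] --> c n)) /\
    (c n / (ln n%:R ^+ k.-1 / ((k.-1)`!%:R * n%:R)) @[n --> \oo] --> (1 : R)).
Proof.
(* The common limit is the proportion of permutations of [n] letters with [k] cycles. *)
exists (cyc R k); split=> [Fq Fqq [//|n] _|]; last first.
  by case: k hk => // k _; exact: cvg_cyc_ratio.
split.
- apply: (@prob_event_cvg R k n Fq (fun F => has_distinct_irr_factors k)) => //.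
    by move=> F f; exact: sqfree_split_distinct.
  by move=> F f j; exact: distinct_sqfree_split.
- apply: (@prob_event_cvg R k n Fq (fun F => has_irr_factors_with_mult k)) => //.
    by move=> F f; exact: sqfree_split_with_mult.
  by move=> F f j; exact: with_mult_sqfree_split.
Qed.
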